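(* Let a framed $SU(2)$ Bogomolny monopole of charge $k$ have spectral curve $P(\eta,\zeta)=0$ and rational map $p/q$. Then the monopole obtained from it by inversion in the plane $x_3=0$ has spectral curve $P(\eta,-\zeta)=0$ and rational map $I(p)/q$, where $I(p)$ is the polynomial of degree less than $k$ determined by $I(p)\,p=1 \bmod q$.
   Context: Monopoles. Consider pairs $(A,\phi)$ on $\mathbf R^3$, $A$ an $\mathfrak{su}(2)$-valued connection 1-form, $\phi:\mathbf R^3\to\mathfrak{su}(2)$, satisfying the Bogomolny equation $\star F_A=\nabla_A\phi$ (with $F_A=dA+A\wedge A$, $\nabla_A\phi=d\phi+[A,\phi]$), finite energy $\int(|F_A|^2+|\nabla_A\phi|^2)d^3x$, and the standard boundary conditions $|\phi|=1-\frac{k}{2r}+O(r^{-2})$, $\partial|\phi|/\partial\Omega=O(r^{-2})$, $|\nabla_A\phi|=O(r^{-2})$ (norm with $|\mathrm{diag}(i,-i)|=1$), where the charge $k\ge1$ is the degree of $\phi$ at infinity. The pair is framed if $\lim_{x_3\to\infty}\phi(0,0,x_3)=\mathrm{diag}(i,-i)$. A framed monopole is a framed pair modulo gauge transformations $g:\mathbf R^3\to SU(2)$ with $\lim_{x_3\to\infty}g(0,0,x_3)=1$. Twistor space. Oriented lines in $\mathbf R^3$ form $TP_1$, with coordinates $(\eta,\zeta)$ (the tangent vector $\eta\,\partial/\partial\zeta$ at $\zeta$): the line through $x$ with unit direction $u$ has $\zeta=(u_1+iu_2)/(1+u_3)$, $\eta=(x_1+ix_2)-2x_3\zeta-(x_1-ix_2)\zeta^2$.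 Let $U_0=\{\zeta\neq\infty\}$, $U_1=\{\zeta\ne0\}$. The line bundle $L^\lambda(n)$ on $TP_1$ is such that a section is given by functions $f_0,f_1$ on $U_0,U_1$ with $f_0=\zeta^{n}\exp(-\lambda\eta/\zeta)f_1$ on $U_0\cap U_1$; $L^\lambda=L^\lambda(0)$. The real structure is $\tau(\eta,\zeta)=(-\bar\eta/\bar\zeta^2,-1/\bar\zeta)$, and for a section $s$ of $L^2$ over a $\tau$-invariant curve, $\tau(s)$ is the section of $L^{-2}$ with $\tau(s)_0=\overline{s_1\circ\tau}$, $\tau(s)_1=\overline{s_0\circ\tau}$. Spectral data. Solutions of $(\nabla_\gamma-i\phi)v=0$ along oriented lines $\gamma$ form a holomorphic rank 2 bundle $E$ on $TP_1$, with line subbundles $E_1^\pm$ of solutions decaying at the $\pm\infty$ end of $\gamma$; $E_1^\pm\cong L^{\pm1}(-k)$, the isomorphisms being determined by the framing. The spectral curve $S$ is the zero divisor of $E_1^+\to E/E_1^-$; it is compact, $\tau$-invariant, with equation $P(\eta,\zeta)\equiv\eta^k+\eta^{k-1}a_1(\zeta)+\dots+a_k(\zeta)=0$, $\deg a_r\le 2r$. On $S$ one has $E_1^+=E_1^-$, which gives a nowhere vanishing holomorphic section $s$ of $L^2|_S$ with $\tau(s)s=1$; given $S$, such $s$ is unique up to a unit scalar, and the choice corresponds to the framing. A framed monopole is determined by $(S,s)$. Rational map. For a framed monopole with data $(S,s)$, put $q(z)=P(z,0)$, monic of degree $k$, and let $p(z)$ be the unique polynomial of degree less than $k$ with $p(z)=s_0(z,0)\bmod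 q(z)$ (if $q$ has distinct roots $\beta_i$, then $p(\beta_i)=s_0(\beta_i,0)$). The rational map is $R=p/q$; $p$ and $q$ are coprime. Inversion. The inversion $I(x_1,x_2,x_3)=(x_1,x_2,-x_3)$ of $\mathbf R^3$ induces on $TP_1$ the antiholomorphic map $I(\eta,\zeta)=(-\bar\eta/\bar\zeta^2,1/\bar\zeta)$. The inverted monopole of the one with data $(S,s)$ is the framed monopole with data $(I(S),I(s))$, where $I(s)_0=\overline{s_1\circ I}$, $I(s)_1=\overline{s_0\circ I}$.
   Formalization: With the stated convention τ(s)s=1 has no solution for even charge (e.g. η²+(π²/4)ζ²=0 forces τ(s)s<0); the formal statement allows a common sign ± in the definitions of τ(s) and I(s), the plus sign being the literal text and the minus sign covering even charge. *)

(* Defs.v *)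
From HB Require Import structures.
From mathcomp Require Export all_boot all_order all_algebra.
From mathcomp Require Export all_classical all_reals all_analysis.
From mathcomp Require Export complex.
From mathcomp Require Import ring.

Set Implicit Arguments.
Unset Strict Implicit.
Unset Printing Implicit Defensive.

Import Order.TTheory GRing.Theory Num.Theory numFieldNormedType.Exports.
Local Open Scope classical_set_scope.
Local Open Scope ring_scope.

Section Fields.
Variable R : realType.
Local Notation C := R[i].
Local Notation R3 := (R * R * R)%type.
Local Notation im := (Complex 0 1 : C).

Definition crd (x : R3) (j : 'I_3) : R :=
  if val j is 0%N then x.1.1 else if val j is 1%N then x.1.2 else x.2.

Definition dir (j : 'I_3) : R3 :=
  ((val j == 0%N)%:R, (val j == 1%N)%:R, (val j == 2%N)%:R).

Definition radius (x : R3) : R := Num.sqrt (\sum_j crd x j ^+ 2).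

Fixpoint Ck (n : nat) (f : R3 -> R) : Prop :=
  if n is m.+1 then
    (forall x, differentiable f x) /\ (forall j, Ck m (fun x => 'D_(dir j) f x))
  else continuous f.

Definition smooth (f : R3 -> R) : Prop := forall n, Ck n f.

Definition csmooth (f : R3 -> C) : Prop :=
  smooth (fun x => complex.Re (f x)) /\ smooth (fun x => complex.Im (f x)).

Definition cderiv (j : 'I_3) (f : R3 -> C) (x : R3) : C :=
  Complex ('D_(dir j) (fun y => complex.Re (f y)) x)
          ('D_(dir j) (fun y => complex.Im (f y)) x).

Definition mxderiv (m n : nat) (j : 'I_3) (X : R3 -> 'M[C]_(m, n)) (x : R3) :
  'M[C]_(m, n) := \matrix_(a, b) cderiv j (fun y => X y a b) x.

Definition cto0 (f : R -> C) : Prop :=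
  complex.Re (f t) @[t --> +oo] --> (0 : R) /\
  complex.Im (f t) @[t --> +oo] --> (0 : R).

Definition cexp (z : C) : C :=
  Complex (expR (complex.Re z) * cos (complex.Im z))
          (expR (complex.Re z) * sin (complex.Im z)).

Definition su2 (X : 'M[C]_2) : Prop :=
  (map_mx Num.conj X)^T = - X /\ \tr X = 0.

(* normalised so that diag(i,-i) has norm 1 *)
Definition su2norm2 (X : 'M[C]_2) : R :=
  2^-1 * \sum_a \sum_b (complex.Re (X a b) ^+ 2 + complex.Im (X a b) ^+ 2).

Definition su2norm (X : 'M[C]_2) : R := Num.sqrt (su2norm2 X).

(* coordinates of X in the orthonormal basis (i sigma_1, i sigma_2, i sigma_3)
   of su(2), sigma_j being the Pauli matrices *)
Definition su2vec (X : 'M[C]_2) (j : 'I_3) : R :=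
  crd (complex.Im (X 0 1), complex.Re (X 0 1), complex.Im (X 0 0)) j.

Definition diagi : 'M[C]_2 :=
  \matrix_(a, b) (if a == b then (-1) ^+ (val a) * im else 0).

Record field := Field { conn : 'I_3 -> R3 -> 'M[C]_2; higgs : R3 -> 'M[C]_2 }.

Definition comm (X Y : 'M[C]_2) : 'M[C]_2 := X *m Y - Y *m X.

Definition curv (M : field) (i j : 'I_3) (x : R3) : 'M[C]_2 :=
  mxderiv i (conn M j) x - mxderiv j (conn M i) x
  + comm (conn M i x) (conn M j x).

Definition dhiggs (M : field) (j : 'I_3) (x : R3) : 'M[C]_2 :=
  mxderiv j (higgs M) x + comm (conn M j x) (higgs M x).

(* the indices are added modulo 3, so (i, i+1, i+2) is a cyclic permutation
   of (0, 1, 2) and (star F)_(i+2) = F_(i,i+1) *)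
Definition bogomolny (M : field) : Prop :=
  forall (i : 'I_3) x, curv M i (i + 1) x = dhiggs M (i + 1 + 1) x.

Definition dhiggs_norm2 (M : field) (x : R3) : R :=
  \sum_j su2norm2 (dhiggs M j x).

Definition energy_density (M : field) (x : R3) : R :=
  \sum_(i < 3) su2norm2 (curv M i (i + 1) x) + dhiggs_norm2 M x.

Definition finite_energy (M : field) : Prop :=
  (\int[(@lebesgue_measure R \x @lebesgue_measure R) \x @lebesgue_measure R]_x
     (energy_density M x)%:E < +oo)%E.

(* The derivatives of |phi| along the rotation fields x_i d_j - x_j d_i are its
   derivatives on the unit sphere of directions. *)
Definition boundary_conditions (k : nat) (M : field) : Prop :=
  exists K r0 : R, 0 < r0 /\ forall x, r0 <= radius x ->
    [/\ `| su2norm (higgs M x) - (1 - k%:R / (2 * radius x)) |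
          <= K / radius x ^+ 2,
        forall i : 'I_3,
          `| 'D_(crd x i *: dir (i + 1) - crd x (i + 1) *: dir i)
               (fun y => su2norm (higgs M y)) x | <= K / radius x ^+ 2
      & Num.sqrt (dhiggs_norm2 M x) <= K / radius x ^+ 2].

Definition sphere (r t f : R) : R3 :=
  (r * sin t * cos f, r * sin t * sin f, r * cos t).

(* the pullback of the area form of the unit sphere of su(2) by phi/|phi|, in
   spherical coordinates on the sphere of radius r *)
Definition degree_density (M : field) (r t f : R) : R :=
  let V s g j := su2vec (higgs M (sphere r s g)) j in
  \det (\matrix_(a < 3, j < 3)
      crd (V t f j, derive1 (fun s => V s f j) t, derive1 (fun g => V t g j) f) a)
  / su2norm (higgs M (sphere r t f)) ^+ 3.

(* With su(2) oriented by (i sigma_1, i sigma_2, i sigma_3), the degree is the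
   positive k of the boundary conditions when star F = D phi. *)
Definition degree_at_infinity (M : field) (k : nat) : Prop :=
  exists r0 : R, 0 < r0 /\ forall r, r0 <= r ->
    Rintegral (@lebesgue_measure R) `[0, pi] (fun t =>
      Rintegral (@lebesgue_measure R) `[0, 2 * pi] (fun f =>
        degree_density M r t f)) = 4 * pi * k%:R.

Definition framed (M : field) : Prop :=
  forall a b, cto0 (fun t => higgs M (0, 0, t) a b - diagi a b).

(* A framed monopole is given by a representative of its gauge class. *)
Record framed_monopole (k : nat) (M : field) : Prop := {
  charge_gt0 : (0 < k)%N;
  conn_smooth : forall j a b, csmooth (fun x => conn M j x a b);
  higgs_smooth : forall a b, csmooth (fun x => higgs M x a b);
  conn_su2 : forall j x, su2 (conn M j x);
  higgs_su2 : forall x, su2 (higgs M x);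
  monopole_eq : bogomolny M;
  monopole_energy : finite_energy M;
  monopole_boundary : boundary_conditions k M;
  monopole_charge : degree_at_infinity M k;
  monopole_framed : framed M
}.

End Fields.

Section Twistor.
Variable R : realType.
Local Notation C := R[i].
Local Notation C2 := (C^o * C^o)%type.

(* A point of TP_1 is (eta, zeta) in the chart U_0, and (eta/zeta^2, 1/zeta) in
   the chart U_1; both charts are copies of C^2. The booleans false and true
   stand for U_0 and U_1. *)
Definition swap (p : C2) : C2 := (p.1 / p.2 ^+ 2, p.2^-1).

Definition chartfun := bool -> C2 -> C^o.

Definition tau (p : C2) : C2 := (- (p.1^* / p.2^* ^+ 2), - (p.2^*)^-1)%R.
Definition inv3 (p : C2) : C2 := (- (p.1^* / p.2^* ^+ 2), (p.2^*)^-1)%R.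

(* tau and the inversion exchange U_0 and U_1. These are their expressions
   from one chart to the other, in either direction, including at zeta = 0 and
   zeta = infinity. *)
Definition tau_chart (p : C2) : C2 := (- p.1^*, - p.2^*)%R.
Definition inv3_chart (p : C2) : C2 := (- p.1^*, p.2^*)%R.

Lemma tau_chart01 p : p.2 != 0 -> swap (tau p) = tau_chart p.
Proof.
case: p => h z /= z0; have cz : (z^* != 0)%R by rewrite conjC_eq0.
rewrite /swap /tau /tau_chart /=; congr pair; last by rewrite invrN invrK.
by field.
Qed.

Lemma tau_chart10 p : p.2 != 0 -> tau_chart (swap p) = tau p.
Proof.
case: p => h z /= z0.
by rewrite /swap /tau /tau_chart /= rmorphM /= !fmorphV /= rmorphXn.
Qed.

Lemma inv3_chart01 p : p.2 != 0 -> swap (inv3 p) = inv3_chart p.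
Proof.
case: p => h z /= z0; have cz : (z^* != 0)%R by rewrite conjC_eq0.
rewrite /swap /inv3 /inv3_chart /=; congr pair; last by rewrite invrK.
by field.
Qed.

Lemma inv3_chart10 p : p.2 != 0 -> inv3_chart (swap p) = inv3 p.
Proof.
case: p => h z /= z0.
by rewrite /swap /inv3 /inv3_chart /= rmorphM /= !fmorphV /= rmorphXn.
Qed.

Definition holo_on (D : set C2) (f : C2 -> C^o) : Prop :=
  forall p, D p -> differentiable f p.

Definition holo (f : chartfun) : Prop := forall c, holo_on setT (f c).

Definition nowhere0 (f : chartfun) : Prop := forall c p, f c p != 0.

(* An effective divisor is given by local equations on U_0 and U_1, which are
   defined up to nowhere vanishing holomorphic factors. *)
Definition same_divisor (f g : chartfun) : Prop :=
  exists u : chartfun,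
    [/\ holo u, nowhere0 u & forall c p, f c p = u c p * g c p].

(* The action of an antiholomorphic involution m exchanging U_0 and U_1 (given
   by its expression between the charts) on divisors and on sections of
   L^lambda: f_0 |-> conj(f_1 o m), f_1 |-> conj(f_0 o m). The sign e selects
   one of its two lifts, the usual one being e = false. For sections of L^2 on
   spectral curves the sign of s tau(s) is determined by the curve, and e = true
   serves the curves where it is negative: for
   eta^2 + (pi^2/4) zeta^2 = 0 one has s_0 = 1, s_1 = -1 up to a scalar, so
   s_0 conj(s_1 o tau) = -1. *)
Definition conj_pull (e : bool) (m : C2 -> C2) (f : chartfun) : chartfun :=
  fun c p => (-1) ^+ e * (f (~~ c) (m p))^*%R.

Record curve_section := CurveSection { crv : chartfun; sec : chartfun }.

Definition inverted_data (e : bool) (D : curve_section) : curve_section :=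
  CurveSection (conj_pull false inv3_chart (crv D))
               (conj_pull e inv3_chart (sec D)).

(* P is a polynomial in eta whose coefficients are polynomials in zeta. *)
Definition curve_form (k : nat) (P : {poly {poly C}}) : Prop :=
  [/\ P \is monic, size P = k.+1 &
      forall r, (r <= k)%N -> (size (P`_(k - r))%R <= (2 * r).+1)%N].

(* zeta^(-2k) P(eta, zeta) in the coordinates of U_1 *)
Definition other_chart (k : nat) (P : {poly {poly C}}) : {poly {poly C}} :=
  \poly_(i < k.+1) \poly_(j < (2 * (k - i)).+1) P`_i`_(2 * (k - i) - j).

Definition poly2_eval (P : {poly {poly C}}) (p : C2) : C := P.[p.1%:P].[p.2].

Definition poly_divisor (k : nat) (P : {poly {poly C}}) : chartfun :=
  fun c => poly2_eval (if c then other_chart k P else P).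

Definition has_equation (k : nat) (S : chartfun) (P : {poly {poly C}}) : Prop :=
  curve_form k P /\ same_divisor S (poly_divisor k P).

(* P(eta, -zeta) *)
Definition flip_zeta (P : {poly {poly C}}) : {poly {poly C}} :=
  map_poly (fun a => a \Po - 'X) P.

(* P(z, 0) *)
Definition at_zeta0 (P : {poly {poly C}}) : {poly C} :=
  map_poly (fun a => a.[0]) P.

End Twistor.

Section SpectralData.
Variable R : realType.
Local Notation C := R[i].
Local Notation C2 := (C^o * C^o)%type.
Local Notation R3 := (R * R * R)%type.
Local Notation im := (Complex 0 1 : C).

(* zeta = a/b for the homogeneous coordinates (a, b) = hom c z; z is zeta on
   U_0 and 1/zeta on U_1. *)
Definition hom (c : bool) (z : C) : C * C := if c then (1, z) else (z, 1).

(* the unit vector u with (u_1 + i u_2)/(1 + u_3) = a/b *)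
Definition direction (c : bool) (z : C) : R3 :=
  let: (a, b) := hom c z in
  let n2 w := complex.Re w ^+ 2 + complex.Im w ^+ 2 in
  let w := a * b^*%R in
  (n2 a + n2 b)^-1 *: (2 * complex.Re w, 2 * complex.Im w, n2 b - n2 a).

(* the point of TP_1 given by the line through x of direction z: on U_0 its
   first coordinate is (x_1 + i x_2) - 2 x_3 zeta - (x_1 - i x_2) zeta^2 *)
Definition line_through (c : bool) (x : R3) (z : C) : C2 :=
  let: (a, b) := hom c z in
  (Complex x.1.1 x.1.2 * b ^+ 2 - 2 * Complex x.2 0 * a * b
     - Complex x.1.1 (- x.1.2) * a ^+ 2, z).

Definition covd (M : field R) (j : 'I_3) (v : R3 -> 'cV[C]_2) (x : R3) :
  'cV[C]_2 := mxderiv j v x + conn M j x *m v x.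

(* A section v of E over a chart is a function of a line and a point x of the
   line, that is, of x and z. With (a, b) = hom c z, the operators
     D1 = a (D_1 - i D_2) + b (D_3 - i phi),
     D2 = b (D_1 + i D_2) - a (D_3 + i phi)
   satisfy  conj(b) D1 + conj(a) D2 = (|a|^2 + |b|^2) (D_u - i phi)  for u the
   direction of the line, so that v solves (D_u - i phi) v = 0 along each line.
   Their scalar parts span the vector fields in x that kill
   eta(x, z). The Bogomolny equation says that D1 and D2 commute, and D1, D2,
   d/d(conj z) is the Cauchy-Riemann operator of E pulled back to the space of
   pairs (x, z). *)
Definition lax1 (M : field R) (c : bool) (z : C) (v : R3 -> 'cV[C]_2) (x : R3) :
  'cV[C]_2 :=
  let: (a, b) := hom c z in
  a *: (covd M 0 v x - im *: covd M 1 v x)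
  + b *: (covd M (1 + 1) v x - im *: (higgs M x *m v x)).

Definition lax2 (M : field R) (c : bool) (z : C) (v : R3 -> 'cV[C]_2) (x : R3) :
  'cV[C]_2 :=
  let: (a, b) := hom c z in
  b *: (covd M 0 v x + im *: covd M 1 v x)
  - a *: (covd M (1 + 1) v x + im *: (higgs M x *m v x)).

(* The values of a section at (x, z), over U_0 and over U_1. *)
Definition chartsec := bool -> R3 -> C^o -> 'cV[C]_2.

Record holo_section (M : field R) (v : chartsec) : Prop := {
  hs_cont : forall c i,
    continuous (fun y : R3 * C^o => complex.Re (v c y.1 y.2 i 0)) /\
    continuous (fun y : R3 * C^o => complex.Im (v c y.1 y.2 i 0));
  hs_smooth : forall c z i, csmooth (fun x => v c x z i 0);
  hs_holo : forall c x z i, derivable (fun z : C^o => v c x z i 0 : C^o) z 1;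
  hs_lax1 : forall c x z, lax1 M c z (fun y => v c y z) x = 0;
  hs_lax2 : forall c x z, lax2 M c z (fun y => v c y z) x = 0
}.

(* v is a local frame of E_1^+ (l = 1) or E_1^- (l = -1) on each chart, the two
   frames being those that correspond to the standard ones of L^l(-k). *)
Definition subbundle_frame (M : field R) (k : nat) (l : R) (v : chartsec) :
  Prop :=
  [/\ holo_section M v,
      forall c x z, v c x z != 0,
      forall c x z i, cto0 (fun t => v c (x + (l * t) *: direction c z) z i 0)
    & forall x z, z != 0 ->
        v true x z^-1
        = (z ^- k * cexp (- (Complex l 0 * (line_through false x z).1 / z)))
            *: v false x z].

(* t^(k/2) e^(-t), the decay rate of solutions given by |phi| = 1 - k/2r *)
Definition decay (k : nat) (t : R) : R := Num.sqrt t ^+ k * expR (- t).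

(* The end x_1 = x_2 = 0, x_3 -> +oo is the positive end of the line
   eta = zeta = 0 (the origin of U_0), and the negative end of the same line
   with the opposite orientation (the origin of U_1). There the framing
   identifies the decaying solutions for E_1^+ and E_1^- with the eigenlines
   of diag(i,-i). This fixes the isomorphisms E_1^+- = L^(+-1)(-k), which are
   unique up to a scalar. *)
Definition framing_normalised (k : nat) (vp vm : chartsec) : Prop :=
  forall i : 'I_2,
    cto0 (fun t => vp false (0, 0, t) 0 i 0 / Complex (decay k t) 0
                   - (i == 0)%:R) /\
    cto0 (fun t => vm true (0, 0, t) 0 i 0 / Complex (decay k t) 0
                   - (i == 1)%:R).

Definition det2 (v w : 'cV[C]_2) : C := v 0 0 * w 1 0 - v 1 0 * w 0 0.

(* A section of a line bundle over the curve with local equations S, which may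
   be singular or non-reduced, is given by functions on U_0 and U_1 modulo S;
   as the charts are C^2, functions on S in a chart extend to it. *)
Definition L2_section (S s : chartfun R) : Prop :=
  holo s /\
  exists2 g : C2 -> C^o, holo_on [set p | p.2 != 0] g &
    forall p, p.2 != 0 ->
      s false p - cexp (- (2 * p.1 / p.2)) * s true (swap p)
      = S false p * g p.

Definition nowhere0_on (S s : chartfun R) : Prop :=
  forall c p, S c p = 0 -> s c p != 0.

Definition tau_normalised (e : bool) (S s : chartfun R) : Prop :=
  exists2 g : chartfun R, holo g &
    forall c p, conj_pull e (@tau_chart R) s c p * s c p - 1 = S c p * g c p.

(* D = (S, s) is the spectral data of M. Since Lambda^2 E is trivial,
   E/E_1^- is identified by det2(_, vm) on each chart, so E_1^+ -> E/E_1^- is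
   det2 vp vm, which depends on the line only. On S the frames of E_1^+ = E_1^-
   are related by vm = s vp. *)
Definition spectral_data (k : nat) (e : bool) (M : field R)
    (D : curve_section R) : Prop :=
  let S := crv D in let s := sec D in
  exists vp vm : chartsec,
  [/\ [/\ subbundle_frame M k 1 vp, subbundle_frame M k (-1) vm
        & framing_normalised k vp vm],
      [/\ holo S,
          exists u : chartfun R, [/\ holo u, nowhere0 u &
            forall c x z, det2 (vp c x z) (vm c x z)
              = u c (line_through c x z) * S c (line_through c x z)]
        & same_divisor (conj_pull false (@tau_chart R) S) S],
      [/\ L2_section S s, nowhere0_on S s & tau_normalised e S s]
    & exists2 w : chartsec, holo_section M w &
        forall c x z, vm c x z - s c (line_through c x z) *: vp c x z
                      = S c (line_through c x z) *: w c x z].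

Definition has_spectral_curve (k : nat) (e : bool) (M : field R)
    (P : {poly {poly C}}) : Prop :=
  exists2 D, spectral_data k e M D & has_equation k (crv D) P.

(* f(z) = p(z) mod q(z), for an entire function f *)
Definition entire_mod (f : C -> C) (p q : {poly C}) : Prop :=
  exists2 h : C^o -> C^o, (forall z, derivable h z 1) &
    forall z, f z = p.[z] + q.[z] * h z.

Definition has_rational_map (k : nat) (e : bool) (M : field R)
    (p q : {poly C}) : Prop :=
  exists D P,
    [/\ spectral_data k e M D, has_equation k (crv D) P, q = at_zeta0 P,
        (size p <= k)%N & entire_mod (fun z => sec D false (z, 0)) p q].

(* M' is the inverse of M in the plane x_3 = 0. As a framed monopole is
   determined by (S, s), this is expressed on the spectral data, which M only
   determines up to units (for S) and modulo the ideal of S (for s). *)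
Definition is_inverted (k : nat) (e : bool) (M M' : field R) : Prop :=
  forall D, spectral_data k e M D -> spectral_data k e M' (inverted_data e D).

Definition is_inverse_mod (k : nat) (p q ip : {poly C}) : Prop :=
  (size ip <= k)%N /\ (ip * p) %% q = 1 %% q.

End SpectralData.

(* Main.v *)
(* The inversion is tau composed with (eta, zeta) |-> (eta, -zeta). As the curve
   is tau-invariant, its inverse is its pullback by the latter map. Over zeta = 0
   the sections I(s) and tau(s) have the same first component, so tau(s) s = 1
   on the curve gives I(s)_0 s_0 = 1 mod q there. *)

From mathcomp Require Import ring.
Require Import Defs.

Set Implicit Arguments.
Unset Strict Implicit.
Unset Printing Implicit Defensive.

Import Order.TTheory GRing.Theory Num.Theory numFieldNormedType.Exports.
Local Open Scope ring_scope.

Lemma coef_comp_polyNX (R : comNzRingType) (a : {poly R}) n :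
  (a \Po - 'X)`_n = (-1) ^+ n * a`_n.
Proof.
have -> : a \Po - 'X = \poly_(i < size a) ((-1) ^+ i * a`_i).
  rewrite poly_def comp_polyE; apply: eq_bigr => i _.
  (* The sign occurs in [R] on one side and in [{poly R}] on the other; once both are powers of the
     parity of [i], one case analysis settles them. *)
  rewrite [in LHS]exprNn -(signr_odd R) -(signr_odd {poly R}); case: odd;
    rewrite ?expr1 ?expr0 ?mul1r //.
  by rewrite !mulN1r scaleNr scalerN.
by rewrite coef_poly; case: ltnP => // /(nth_default 0) ->; rewrite mulr0.
Qed.

Lemma size_comp_polyNX (R : comNzRingType) (a : {poly R}) :
  (size (a \Po - 'X) <= size a)%N.
Proof.
by apply/leq_sizeP => j /(nth_default 0) aj; rewrite coef_comp_polyNX aj mulr0.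
Qed.

Lemma derivable_poly (F : numFieldType) (p : {poly F}) (x v : F^o) :
  derivable (fun z : F^o => p.[z] : F^o) x v.
Proof.
elim/poly_ind: p => [|p c IH].
  rewrite (_ : (fun _ => _) = cst 0); first exact: derivable_cst.
  by apply/funext => z; rewrite horner0.
rewrite (_ : (fun _ => _) = (fun z : F^o => p.[z] : F^o) * id + cst c).
  by apply: derivableD; [apply: derivableM => //; exact: derivable_id
                        |exact: derivable_cst].
by apply/funext => z; rewrite hornerMXaddC.
Qed.

(** The inverse is the Bezout coefficient of [p]; reducing it modulo [q] gives the degree bound. *)
Lemma is_inverse_mod_ex (R : realType) (k : nat) (p q : {poly R[i]}) :
  size q = k.+1 -> coprimep p q -> exists ip, is_inverse_mod k p q ip.
Proof.
move=> sq /Bezout_eq1_coprimepP[[u v] /= e]; exists (u %% q).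
split; first by rewrite -ltnS -sq ltn_modp -size_poly_gt0 sq.
by rewrite mulrC modp_mul mulrC -e modpD modp_mull addr0.
Qed.

(** By Gauss, [q] divides the difference of two inverses, whose degree is too small unless it
    vanishes. *)
Lemma is_inverse_mod_uniq (R : realType) (k : nat) (p q ip ip' : {poly R[i]}) :
  size q = k.+1 -> coprimep p q ->
  is_inverse_mod k p q ip -> is_inverse_mod k p q ip' -> ip' = ip.
Proof.
move=> sq cpq [si ei] [si' ei']; apply/eqP; rewrite -subr_eq0.
have : q %| (ip' - ip) * p.
  by apply/modp_eq0P; rewrite mulrBl modpD modpN ei ei' subrr.
rewrite Gauss_dvdpl 1?coprimep_sym // => /modp_eq0P.
rewrite modp_small => [->//|]; rewrite sq ltnS.
by apply: (leq_trans (size_polyD _ _)); rewrite size_polyN geq_max si si'.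
Qed.

Section FlipZeta.
Variable R : realType.
Local Notation C := R[i].
Implicit Types (P : {poly {poly C}}) (x y : C).

Lemma coef_flip_zeta P i : (flip_zeta P)`_i = P`_i \Po - 'X.
Proof. exact: (coef_map (comp_poly (- 'X))). Qed.

Lemma horner_flip_zeta P x y :
  poly2_eval (flip_zeta P) (x, y) = poly2_eval P (x, - y).
Proof.
(* The constant [x%:P] is its own image under the ring morphism [comp_poly (- 'X)], so evaluation at
   it commutes with the morphism. *)
rewrite /poly2_eval /= -[x%:P in LHS](comp_polyC x (- 'X)).
by rewrite (horner_map (comp_poly (- 'X))) /= horner_comp hornerN hornerX.
Qed.

Lemma at_zeta0_flip P : at_zeta0 (flip_zeta P) = at_zeta0 P.
Proof.
apply/polyP => i; rewrite !(coef_map (horner_eval 0)) coef_flip_zeta.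
by rewrite [LHS]horner_comp hornerN hornerX oppr0.
Qed.

Lemma horner_at_zeta0 P x : (at_zeta0 P).[x] = poly2_eval P (x, 0).
Proof.
rewrite /poly2_eval /= -[x in LHS](hornerC x 0).
exact: (horner_map (horner_eval 0)).
Qed.

Lemma coef_other_chart k P i j :
  (other_chart k P)`_i`_j =
  if (i < k.+1)%N && (j < (2 * (k - i)).+1)%N
  then P`_i`_(2 * (k - i) - j) else 0.
Proof.
by rewrite coef_poly; case: ifP => _ /=; rewrite ?coef0 // coef_poly.
Qed.

(** Reversing coefficients sends the exponent [j] to [2 * (k - i) - j], which has the same parity,
    so the signs agree in both charts. *)
Lemma other_chart_flip k P :
  other_chart k (flip_zeta P) = flip_zeta (other_chart k P).
Proof.
apply/polyP => i; apply/polyP => j; rewrite coef_flip_zeta coef_comp_polyNX.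
rewrite !coef_other_chart; case: ifP => [/andP[_ ltj]|_]; last by rewrite mulr0.
rewrite coef_flip_zeta coef_comp_polyNX; congr (_ * _).
by rewrite -signr_odd oddB // oddM /= signr_odd.
Qed.

Lemma curve_form_flip k P : curve_form k P -> curve_form k (flip_zeta P).
Proof.
move=> [mP sP dP].
have lP : P`_k = 1 by move/monicP: mP; rewrite lead_coefE sP.
have sf : size (flip_zeta P) = k.+1.
  apply/eqP; rewrite eqn_leq; apply/andP; split.
    by rewrite -sP; apply: size_poly.
  rewrite ltnNge; apply/negP => /leq_sizeP/(_ k (leqnn k))/eqP.
  by rewrite coef_flip_zeta lP comp_polyC oner_eq0.
split=> //.
  by rewrite monicE lead_coefE sf coef_flip_zeta lP comp_polyC.
move=> r rk; have := leq_trans (size_comp_polyNX _) (dP r rk).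
by rewrite -coef_flip_zeta.
Qed.

(** Setting zeta = 0 could lower the degree in eta, but the leading coefficient is the constant 1
    and survives. *)
Lemma size_at_zeta0 k P : curve_form k P -> size (at_zeta0 P) = k.+1.
Proof.
move=> [mP sP _]; apply/eqP; rewrite eqn_leq; apply/andP; split.
  by rewrite -sP; apply: size_poly.
rewrite ltnNge; apply/negP => /leq_sizeP/(_ k (leqnn k))/eqP.
have -> : (at_zeta0 P)`_k = 1.
  rewrite (coef_map (horner_eval 0)); move/monicP: mP.
  by rewrite lead_coefE sP => ->; exact: hornerC.
by rewrite oner_eq0.
Qed.

Lemma poly_divisor_flip k P (c : bool) x y :
  poly_divisor k (flip_zeta P) c (x, y) = poly_divisor k P c (x, - y).
Proof.
by case: c; rewrite /poly_divisor ?other_chart_flip horner_flip_zeta.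
Qed.

End FlipZeta.

Section Inversion.
Variable R : realType.
Local Notation C := R[i].
Local Notation C2 := (C^o * C^o)%type.

Lemma inv3_chartE (x y : C) : inv3_chart (x, y) = tau_chart (x, - y).
Proof. by rewrite /inv3_chart /tau_chart /= rmorphN opprK. Qed.

Lemma holo_flip (u : chartfun R) :
  holo u -> holo (fun c z => u c (z.1, - z.2)).
Proof.
move=> hu c z _.
apply: (differentiable_comp (f := fun z : C2 => (z.1, - z.2))); last exact: hu.
apply: differentiable_pair; last apply: differentiableN.
  by apply: (linear_differentiable (f := fst)) => y; exact: cvg_fst.
by apply: (linear_differentiable (f := snd)) => y; exact: cvg_snd.
Qed.

Lemma holo_slice (f : C2 -> C^o) (x : C^o) :
  holo_on setT f -> derivable (fun z : C^o => f (z, 0)) x 1.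
Proof.
move=> hf; apply: diff_derivable.
apply: (differentiable_comp (f := fun z : C^o => (z, 0) : C2)); last exact: hf.
apply: differentiable_pair; last exact: differentiable_cst.
by apply/derivable1_diffP; exact: derivable_id.
Qed.

Lemma holoM (u v : chartfun R) :
  holo u -> holo v -> holo (fun c z => u c z * v c z).
Proof.
by move=> hu hv c z _; apply: differentiableM; [exact: hu|exact: hv].
Qed.

Lemma inverted_equation k e (M : field R) D (P : {poly {poly C}}) :
  spectral_data k e M D -> has_equation k (crv D) P ->
  has_equation k (crv (inverted_data e D)) (flip_zeta P).
Proof.
move=> [vp [vm [_ [_ _ [u [hu nu Su]]] _ _]]] [cP [v [hv nv Sv]]].
split; first exact: curve_form_flip.
(* Here [u] is the unit from the tau-invariance of the curve and [v] the one relating its local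
   equations to [P]; both are taken at (eta, -zeta), where tau gives the inversion. *)
exists (fun c z => u c (z.1, - z.2) * v c (z.1, - z.2)); split.
- exact: (holoM (holo_flip hu) (holo_flip hv)).
- by move=> c z; rewrite mulf_neq0.
- move=> c [x y] /=; rewrite poly_divisor_flip -mulrA -Sv -Su.
  by rewrite /conj_pull inv3_chartE.
Qed.

Lemma inverted_section_mod k e (M : field R) D P :
  spectral_data k e M D -> has_equation k (crv D) P ->
  entire_mod (fun z => sec (inverted_data e D) false (z, 0) *
                       sec D false (z, 0)) 1 (at_zeta0 P).
Proof.
move=> [vp [vm [_ [_ _ _] [_ _ [g hg Sg]] _]]] [cP [v [hv nv Sv]]].
(* The tau-normalisation has error [S * g], and [S = v * P]; on zeta = 0, where [P] restricts to
   [at_zeta0 P], the cofactor is thus [v * g]. *)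
exists (fun z => v false (z, 0) * g false (z, 0)).
  by move=> z; apply: derivableM; apply: holo_slice; [exact: hv|exact: hg].
move=> z; rewrite horner_at_zeta0 hornerC mulrCA mulrA.
have := Sv false (z, 0); rewrite /poly_divisor => <-.
by rewrite -Sg addrC subrK /= /conj_pull inv3_chartE oppr0.
Qed.

(** In the ring of entire functions modulo [q], both [f'] and [ip] invert the class of [f], which is
    that of [p], so they are congruent. Working with cofactors instead of values at the roots covers
    multiple roots of [q]. *)
Lemma entire_mod_inverse (f f' : C^o -> C^o) k (p q ip : {poly C}) :
  (forall z, derivable f' z 1) ->
  entire_mod f p q -> entire_mod (fun z => f' z * f z) 1 q ->
  is_inverse_mod k p q ip -> entire_mod f' ip q.
Proof.
move=> df' [h dh fh] [a da fa] [_ e].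
have [b eb] : exists b, ip * p = 1 + b * q.
  have /modp_eq0P/dvdpP[b eb] : (ip * p - 1) %% q = 0.
    by rewrite modpD modpN e subrr.
  by exists b; rewrite -eb addrC subrK.
pose P (r : {poly C}) (z : C^o) : C^o := r.[z].
have dP r z : derivable (P r) z 1 by exact: derivable_poly.
(* Multiply [ip * p = 1 + b * q] by [f'], then substitute [p = f - q * h] and [f' * f = 1 + q * a]:
   this gives [f' = ip + q * (ip * a - ip * h * f' - b * f')]. *)
exists (P ip * a - P ip * h * f' - P b * f').
  by move=> z; apply: derivableB;
    [apply: derivableB; [exact: derivableM|]|];
    repeat (apply: derivableM => //).
move=> z; rewrite /P /= !fctE.
have := congr1 (horner^~ z) eb; rewrite /= !hornerE => ez.
have := fa z; rewrite hornerC fh => az.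
apply/eqP; rewrite -subr_eq0; apply/eqP.
transitivity (- f' z * (ip.[z] * p.[z] - (1 + b.[z] * q.[z])) +
              ip.[z] * (f' z * (p.[z] + q.[z] * h z) - (1 + q.[z] * a z))).
  ring.
by rewrite ez az !subrr !mulr0 addr0.
Qed.

(** At a common root of [p] and [q] the function [f] would vanish while [f' * f] equals 1; over an
    algebraically closed field, having no common root is coprimality. *)
Lemma entire_mod_unit_coprimep (f f' : C -> C) (p q : {poly C}) :
  entire_mod f p q -> entire_mod (fun z => f' z * f z) 1 q -> coprimep p q.
Proof.
move=> [h _ fh] [a _ fa]; rewrite coprimep_sym.
apply: Pdiv.ClosedField.root_coprimep => x /rootP qx; apply/negP => /eqP px.
have := fa x; rewrite fh px qx hornerC !mul0r !addr0 mulr0 => /esym/eqP.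
by rewrite oner_eq0.
Qed.

End Inversion.

Unset Implicit Arguments.

Theorem proposition1 (R : realType) (k : nat) (e : bool) (M M' : field R)
    (hM : framed_monopole k M) (hM' : framed_monopole k M')
    (hinv : is_inverted k e M M')
    (P : {poly {poly R[i]}}) (hP : has_spectral_curve k e M P)
    (p q : {poly R[i]}) (hpq : has_rational_map k e M p q) :
  has_spectral_curve k e M' (flip_zeta P) /\
  exists ip : {poly R[i]},
    [/\ is_inverse_mod k p q ip,
        forall ip' : {poly R[i]}, is_inverse_mod k p q ip' -> ip' = ip
      & has_rational_map k e M' ip q].
Proof.
split.
  case: hP => D sD eD; exists (inverted_data e D); first exact: hinv.
  exact: inverted_equation sD eD.
(* The rational map comes with its own data [D] and equation [P0], possibly different from those
   behind [hP], so the inverted equation is derived again for [P0]. *)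
case: hpq => D [P0 [sD eD -> sp spq]].
have sq := size_at_zeta0 eD.1; have mod1 := inverted_section_mod sD eD.
have cpq := entire_mod_unit_coprimep spq mod1.
have [ip iip] := is_inverse_mod_ex sq cpq.
exists ip; split=> // [ip'|]; first exact: is_inverse_mod_uniq sq cpq iip.
exists (inverted_data e D), (flip_zeta P0); split.
- exact: hinv.
- exact: inverted_equation sD eD.
- by rewrite at_zeta0_flip.
- by case: iip.
(* Holomorphy of the inverted section is read off from the spectral data of [M']. *)
- have [vp [vm [_ _ [[hs _] _ _] _]]] := hinv _ sD.
  pose s0 (z : R[i]^o) : R[i]^o := sec (inverted_data e D) false (z, 0).
  apply: (@entire_mod_inverse _ _ s0 _ _ _ _ _ spq mod1 iip) => z.
  exact: holo_slice (hs false).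
Qed.
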